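(* Let $n>0$ and let $K$ be a tileable finite $n$-dimensional simplicial complex. Then two tilings $\mathcal{T}$ and $\mathcal{T}'$ of $K$ have the same $h$-vector provided $h_0(\mathcal{T})=h_0(\mathcal{T}')$. When $h_0(\mathcal{T})=1$, the $h$-vector of $\mathcal{T}$ coincides with the $h$-vector of $K$.
   Context: For $n>0$ and $s\in\{0,\ldots,n+1\}$, a tile of type $T_s^n$ is a closed $n$-simplex deprived of $s$ of its (closed) facets; so $T_0^n$ is the closed $n$-simplex and $T_{n+1}^n$ is the open $n$-simplex. A tiling of an $n$-dimensional simplicial complex $K$ is a partition of $|K|$ into disjoint tiles, each of the form $\sigma$ deprived of $s$ of its facets for some $n$-simplex $\sigma$ of $K$ and some $s\in\{0,\ldots,n+1\}$; $K$ is tileable if it has a tiling. The $h$-vector of a finite tiling $\mathcal{T}$ is $h(\mathcal{T})=(h_0(\mathcal{T}),\ldots,h_{n+1}(\mathcal{T}))$, where $h_s(\mathcal{T})$ is the number of tiles of type $T_s^n$ in $\mathcal{T}$. The $h$-vector $(h_0(K),\ldots,h_{n+1}(K))$ of a finite $n$-dimensional simplicial complex $K$ is defined by $\sum_{i=0}^{n+1}h_i(K)X^{n+1-i}=\sum_{i=0}^{n+1}f_{i-1}(K)(X-1)^{n+1-i}$, where $f_j(K)$ is the number of $j$-simplices of $K$ for $j\geq 0$ and $f_{-1}(K)=1$. *)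

(* Defs.v *)
From HB Require Import structures.
From mathcomp Require Import all_boot all_order all_algebra.
From mathcomp Require Import finmap.
From mathcomp Require Import all_classical all_reals.

Set Implicit Arguments.
Unset Strict Implicit.
Unset Printing Implicit Defensive.

Import Order.TTheory GRing.Theory Num.Theory.
Local Open Scope ring_scope.
Local Open Scope classical_set_scope.

(* The finite type V only hosts the vertices: a point of V is a vertex of K
   when its singleton is a simplex of K. *)
Record simplicial_complex (V : finType) := SimplicialComplex {
  simplices : {set {set V}};
  simplex_nonempty : forall sigma, sigma \in simplices -> sigma != finset.set0;
  simplex_face : forall sigma tau : {set V}, sigma \in simplices ->
    tau \subset sigma -> tau != finset.set0 -> tau \in simplices
}.

Section Complex.
Variables (V : finType) (K : simplicial_complex V).

(* A simplex of dimension j has j.+1 vertices. *)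
Definition of_dimension (n : nat) : Prop :=
  (exists2 sigma, sigma \in simplices K & #|sigma| = n.+1) /\
  (forall sigma, sigma \in simplices K -> (#|sigma| <= n.+1)%N).

Definition num_simplices (j : nat) : nat :=
  #|[set sigma in simplices K | #|sigma| == j.+1]%SET|.

(* The index is shifted by one: fvect i is f_{i-1}(K). *)
Definition fvect (i : nat) : nat :=
  if i is j.+1 then num_simplices j else 1%N.

Definition hpoly (n : nat) : {poly int} :=
  \sum_(i < n.+2) (fvect i)%:R *: ('X - 1) ^+ (n.+1 - i).

Definition hvect_complex (n : nat) : {ffun 'I_n.+2 -> int} :=
  [ffun i : 'I_n.+2 => (hpoly n)`_(n.+1 - i)].

End Complex.

Section Realization.
Variables (R : realType) (V : finType).

(* Points of geometric realizations are given by barycentric coordinates. *)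
Definition hull (sigma : {set V}) : set {ffun V -> R} :=
  [set x : {ffun V -> R} | [/\ forall v, 0 <= x v, \sum_v x v = 1
                   & forall v, v \notin sigma -> x v = 0] ].

Definition realization (K : simplicial_complex V) : set {ffun V -> R} :=
  \bigcup_(sigma in [set` simplices K]) hull sigma.

Definition facets (sigma : {set V}) : {set {set V}} :=
  [set rho : {set V} | (rho \subset sigma) && (#|rho|.+1 == #|sigma|)]%SET.

(* A tile of type T_s^n supported by an n-simplex of K. *)
Definition is_tile (K : simplicial_complex V) (n s : nat)
    (t : set {ffun V -> R}) : Prop :=
  exists (sigma : {set V}) (F : {set {set V}}),
    [/\ sigma \in simplices K, #|sigma| = n.+1, F \subset facets sigma,
        #|F| = s
      & t = hull sigma `\` \bigcup_(rho in [set` F]) hull rho].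

Definition tiling (K : simplicial_complex V) (n : nat)
    (T : set (set {ffun V -> R})) : Prop :=
  (forall t, T t -> exists s : 'I_n.+2, is_tile K n s t) /\
  partition T id (realization K).

(* A tiling of K is a finite set of tiles (tiling_finite below), so fset_set
   takes its meaningful value here. *)
Definition hvect_tiling (K : simplicial_complex V) (n : nat)
    (T : set (set {ffun V -> R})) : {ffun 'I_n.+2 -> nat} :=
  [ffun s : 'I_n.+2 => #|` fset_set [set t | T t /\ is_tile K n s t] |].

End Realization.

Definition tileable (R : realType) (V : finType) (K : simplicial_complex V)
    (n : nat) : Prop :=
  exists T : set (set {ffun V -> R}), tiling K n T.

Lemma hvect_complexE (V : finType) (K : simplicial_complex V) (n : nat) :
  \sum_(i < n.+2) hvect_complex K n i *: 'X^(n.+1 - i)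
  = \sum_(i < n.+2) (fvect K i)%:R *: ('X - 1) ^+ (n.+1 - i) :> {poly int}.
Proof.
rewrite -/(hpoly K n); apply/polyP => k; rewrite coef_sum.
have [kn|nk] := ltnP k n.+2.
  have k'n : (n.+1 - k < n.+2)%N by rewrite ltnS leq_subr.
  rewrite (bigD1 (Ordinal k'n)) //= coefZ coefXn ffunE /= subKn // eqxx mulr1.
  rewrite big1 ?addr0 // => i ni; rewrite coefZ coefXn.
  case: eqP => [ki|_]; last by rewrite mulr0.
  case/eqP: ni; apply: val_inj; rewrite /= ki subKn //.
  by rewrite -ltnS.
have sz : (size (hpoly K n) <= n.+2)%N.
  apply: (leq_trans (size_sum _ _ _)); apply/bigmax_leqP => i _.
  apply: (leq_trans (size_scale_leq _ _)).
  by rewrite -polyC1 size_exp_XsubC ltnS leq_subr.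
rewrite [RHS]nth_default ?(leq_trans sz) // big1 // => i _.
rewrite coefZ coefXn; case: eqP => [ki|_]; last by rewrite mulr0.
by move: nk; rewrite ki ltnNge leq_subr.
Qed.

Lemma tiling_finite (R : realType) (V : finType) (K : simplicial_complex V)
  (n : nat) (T : set (set {ffun V -> R})) : tiling K n T -> finite_set T.
Proof.
move=> [tT _].
pose g (p : {set V} * {set {set V}}) : set {ffun V -> R} :=
  hull p.1 `\` \bigcup_(rho in [set` p.2]) hull rho.
apply: (@sub_finite_set _ _ (g @` setT)); last first.
  exact: finite_image.
by move=> t /tT[s [sigma [F [_ _ _ _ ->]]]]; exists (sigma, F).
Qed.

(* Main.v *)
Require Import Defs.
From mathcomp Require Import all_boot all_order all_algebra.
From mathcomp Require Import finmap.
From mathcomp Require Import all_classical all_reals.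
Import Order.TTheory GRing.Theory Num.Theory.
Local Open Scope ring_scope.

(** A tile carried by an n-simplex sigma is obtained by removing the facets
    opposite to the vertices of some W, a subset of sigma; its points are those
    of sigma whose coordinates at the vertices of W do not vanish. Hence the
    tile is the union of the open simplices tau with W <= tau <= sigma, and its
    type is #|W|. In a tiling, every simplex tau of K therefore lies in exactly
    one of these boolean intervals, namely that of the tile which contains the
    barycenter of tau (card_cells_between).

    Weight tau by (X - 1)^(n+1-#|tau|). By the binomial theorem the weights of
    an interval add up to X^(n+1-#|W|) (sum_between), so the weights of all the
    intervals add up to the sum over s of h_s(T) X^(n+1-s). On the other hand,
    each simplex of K is counted once, and the empty set, of weight
    (X - 1)^(n+1), once for each tile with W empty, that is h_0(T) times,
    whereas the h-polynomial of K counts it once, as f_{-1}(K) = 1. This gives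
    (hvect_tiling_hpoly)

      sum_s h_s(T) X^(n+1-s) = hpoly K n + (h_0(T) - 1) (X - 1)^(n+1),

    whose right-hand side depends on T through h_0(T) only, and is hpoly K n
    when h_0(T) = 1: both claims follow by comparing coefficients.

    The dimension has to be positive for the type of a tile to be well defined
    (half_open_inj): in dimension 0, removing the empty facet from a vertex
    leaves that vertex. *)

Set Implicit Arguments.
Unset Strict Implicit.
Unset Printing Implicit Defensive.

(** * Intervals of the lattice of vertex sets *)

Section BooleanIntervals.
Variable V : finType.
Implicit Types (p : {set V} * {set V}) (tau : {set V}).

(** The interval is encoded as the pair (top, bottom), in the order (simplex,
    vertices opposite to the removed facets) which describes a tile. *)
Definition between p tau : bool := (p.2 \subset tau) && (tau \subset p.1).

(** This is the expansion of a product of binomials, one per vertex: for a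
    vertex v of p.1 outside p.2, y + 1 is the choice between leaving v out of
    tau, at the cost of a factor y, and putting v into tau. *)
Lemma sum_between (S : comNzRingType) (y : S) p :
  p.2 \subset p.1 ->
  \sum_(tau | between p tau) y ^+ (#|p.1| - #|tau|) =
    (y + 1) ^+ (#|p.1| - #|p.2|).
Proof.
case: p => sigma W /= Wsigma.
(* A factor 0 forbids the sets tau which leave the interval at v. *)
pose inside v : S := (v \in sigma)%:R.
pose outside v : S := if v \in sigma then (v \notin W)%:R * y else 1.
have distr : \prod_v (inside v + outside v) =
    \sum_(tau : {set V}) \prod_v (if v \in tau then inside v else outside v).
  exact: bigA_distr.
have expE (c : S) (A B : {set V}) : A \subset B ->
    \prod_v (if v \in B :\: A then c else 1) = c ^+ (#|B| - #|A|).
  by move=> AB; rewrite -big_mkcond prodr_const cardsD (finset.setIidPr AB).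
move: distr; have -> : \prod_v (inside v + outside v) = (y + 1) ^+ (#|sigma| - #|W|).
  rewrite -expE //; apply: eq_bigr => v _; rewrite /inside /outside inE.
  have := fintype.subsetP Wsigma v.
  case: (v \in W) => [->//|_]; first by rewrite mul0r addr0.
  by case: (v \in sigma); rewrite /= ?mul1r ?add0r // addrC.
move=> ->; rewrite big_mkcond /=; apply: eq_bigr => tau _.
rewrite /between /=; case: ifPn => [/andP[Wtau tausigma]|].
  rewrite -expE //; apply: eq_bigr => v _; rewrite /inside /outside inE.
  have := fintype.subsetP Wtau v; have := fintype.subsetP tausigma v.
  case: (v \in tau) => [->//|_ nW].
  case: (v \in sigma) => //=; case: (v \in W) nW => [/(_ isT)//|_].
  by rewrite mul1r.
rewrite negb_and => /orP[] /fintype.subsetPn[v vin vout].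
  rewrite (bigD1 v) //= (negbTE vout) /outside (fintype.subsetP Wsigma _ vin) vin.
  by rewrite !mul0r.
by rewrite (bigD1 v) //= vin /inside (negbTE vout) mul0r.
Qed.

End BooleanIntervals.

(** * Tiles as half-open simplices *)

Section Tiles.
Variables (R : realType) (V : finType).
Implicit Types (p q : {set V} * {set V}) (sigma tau W : {set V}).
Implicit Types (x : {ffun V -> R}).

Definition half_open p : set {ffun V -> R} :=
  [set x | hull p.1 x /\ forall v, v \in p.2 -> x v != 0]%classic.

Definition opposite_facets sigma W : {set {set V}} := [set sigma :\ v | v in W]%SET.

Lemma hull_facet sigma v x :
  hull (sigma :\ v)%SET x <-> hull sigma x /\ x v = 0.
Proof.
split=> [[x0 x1 xs]|[[x0 x1 xs] xv]].
  split; last by apply: xs; rewrite !inE eqxx.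
  by split=> // w ws; apply: xs; rewrite !inE negb_and ws orbT.
by split=> // w; rewrite !inE negb_and negbK => /orP[/eqP->//|/xs].
Qed.

Lemma half_openE sigma W :
  half_open (sigma, W) =
  (hull sigma `\` \bigcup_(rho in [set` opposite_facets sigma W]) hull rho)%classic.
Proof.
apply/seteqP; split=> x /= [xs xW]; split=> //.
  by case=> _ /imsetP[v vW ->] /hull_facet[_ /eqP]; apply/negP/xW.
move=> v vW; apply/negP => /eqP xv; apply: xW.
by exists (sigma :\ v)%SET; [apply/imsetP; exists v|apply/hull_facet].
Qed.

Lemma card_opposite_facets sigma W :
  W \subset sigma -> #|opposite_facets sigma W| = #|W|.
Proof.
move=> /fintype.subsetP Ws; apply: card_in_imset => v w vW wW /setP/(_ v).
by rewrite !inE eqxx (Ws v vW) andbT /=; case: eqP.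
Qed.

Lemma opposite_facets_sub sigma W :
  W \subset sigma -> opposite_facets sigma W \subset facets sigma.
Proof.
move=> /fintype.subsetP Ws; apply/fintype.subsetP => _ /imsetP[v vW ->].
by rewrite inE subD1set (cardsD1 v sigma) (Ws v vW) /=.
Qed.

Lemma opposite_facetsP sigma (F : {set {set V}}) : F \subset facets sigma ->
  exists2 W : {set V}, W \subset sigma & F = opposite_facets sigma W.
Proof.
move=> /fintype.subsetP Fs; exists [set v in sigma | (sigma :\ v)%SET \in F]%SET.
  by apply/fintype.subsetP => v; rewrite inE => /andP[].
apply/setP => rho; apply/idP/imsetP => [rhoF|[v]]; last first.
  by rewrite inE => /andP[_ vF] ->.
have := Fs _ rhoF; rewrite inE => /andP[rhos /eqP crho].
have /cards1P[v Dv] : #|sigma :\: rho| == 1%N.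
  by rewrite cardsD (finset.setIidPr rhos) -crho subSnn.
have vs : v \in sigma by have := set11 v; rewrite -Dv inE => /andP[].
have rhoE : rho = (sigma :\ v)%SET.
  by rewrite -Dv finset.setDDr finset.setDv finset.set0U (finset.setIidPr rhos).
by exists v => //; rewrite inE vs -rhoE.
Qed.

(** Only the support of this point matters: it lies in the open simplex tau, and
    so tells which tile contains that open simplex. *)
Definition barycenter tau : {ffun V -> R} :=
  [ffun v => if v \in tau then #|tau|%:R^-1 else 0].

Lemma barycenter_eq0 tau v : (barycenter tau v == 0) = (v \notin tau).
Proof.
rewrite ffunE; case: ifPn => [vt|_]; last by rewrite eqxx.
rewrite invr_eq0 pnatr_eq0; apply/negbTE; rewrite -lt0n.
by apply/card_gt0P; exists v.
Qed.

Lemma barycenter_hull sigma tau : tau != finset.set0 ->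
  hull sigma (barycenter tau) <-> tau \subset sigma.
Proof.
move=> tau0; split=> [[_ _ xs]|/fintype.subsetP ts].
  apply/fintype.subsetP => v; apply: contraLR => /xs/eqP.
  by rewrite barycenter_eq0.
split=> [v||v vs].
- by rewrite ffunE; case: ifP => // _; rewrite invr_ge0 ler0n.
- under eq_bigr do rewrite ffunE.
  rewrite -big_mkcond sumr_const -[LHS]mulr_natl divff //.
  by rewrite pnatr_eq0 cards_eq0.
- by apply/eqP; rewrite barycenter_eq0; apply: contra vs => /ts.
Qed.

Lemma barycenter_half_open p tau : tau != finset.set0 ->
  half_open p (barycenter tau) <-> between p tau.
Proof.
move=> tau0; split=> [[/(barycenter_hull _ tau0) ts Wt]|/andP[Wt ts]].
  rewrite /between ts andbT; apply/fintype.subsetP => v /Wt.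
  by rewrite barycenter_eq0 negbK.
split; first exact/barycenter_hull.
by move=> v /(fintype.subsetP Wt); rewrite barycenter_eq0 negbK.
Qed.

(** The simplex carrying the tile is the largest support of its points. A vertex
    v of p.2 which is not in q.2 would lie in the supports of all points
    of the tile q, although q.1 :\ v is such a support; it is nonempty because
    q.1 has at least two vertices. *)
Lemma half_open_sub p q : p.2 \subset p.1 -> q.2 \subset q.1 ->
  (1 < #|q.1|)%N -> (half_open q `<=` half_open p)%classic ->
  (q.1 \subset p.1) && (p.2 \subset q.2).
Proof.
move=> p21 q21 q1 qp.
have betw tau : tau != finset.set0 -> between q tau -> between p tau.
  by move=> tau0 /(barycenter_half_open _ tau0)/qp/(barycenter_half_open _ tau0).
have q10 : q.1 != finset.set0 by rewrite -card_gt0 ltnW.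
have /andP[p2q1 ->/=] : between p q.1.
  by apply: betw => //; rewrite /between q21 subxx.
apply/fintype.subsetP => v vp; apply: contraT => vq.
have /andP[/fintype.subsetP/(_ _ vp)] : between p (q.1 :\ v)%SET.
  apply: betw.
    rewrite -card_gt0; move: q1; rewrite (cardsD1 v q.1).
    by case: (v \in _) => //= /ltnW.
  by rewrite /between finset.subsetD1 q21 vq subD1set.
by rewrite !inE eqxx.
Qed.

Lemma half_open_inj p q : p.2 \subset p.1 -> q.2 \subset q.1 ->
  (1 < #|p.1|)%N -> (1 < #|q.1|)%N -> half_open p = half_open q -> p = q.
Proof.
move=> p21 q21 p1 q1 pq.
have /andP[qp1 pq2] : (q.1 \subset p.1) && (p.2 \subset q.2).
  by apply: half_open_sub => //; rewrite pq.
have /andP[pq1 qp2] : (p.1 \subset q.1) && (q.2 \subset p.2).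
  by apply: half_open_sub => //; rewrite pq.
case: p q qp1 pq2 pq1 qp2 {p21 q21 p1 q1 pq} => [a b] [c d] /= *.
by congr pair; apply/eqP; rewrite finset.eqEsubset; apply/andP.
Qed.

Variables (K : simplicial_complex V) (n : nat).

Definition cell p : bool :=
  [&& p.1 \in simplices K, #|p.1| == n.+1 & p.2 \subset p.1].

(** Since half_open is injective on cells, this turns the tiles of a tiling and
    their types into finite combinatorial data. *)
Lemma is_tileP s (t : set {ffun V -> R}) :
  is_tile K n s t <-> exists p, [/\ cell p, #|p.2| = s & t = half_open p].
Proof.
split=> [[sigma [F [sK cs /opposite_facetsP[W Ws ->] <- ->]]]|].
  exists (sigma, W); split; rewrite ?half_openE //=.
    by rewrite /cell /= sK cs eqxx.
  by rewrite card_opposite_facets.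
move=> [[sigma W] [/and3P[/= sK /eqP cs Ws] <- ->]].
exists sigma, (opposite_facets sigma W); split=> //.
- exact: opposite_facets_sub.
- exact: card_opposite_facets.
- exact: half_openE.
Qed.

End Tiles.
(** * Counting the simplices in a tiling *)

Lemma card_fset_set_image (I : finType) (T : choiceType) (f : I -> T)
    (A : {set I}) :
  {in A &, injective f} ->
  #|` fset_set [set f i | i in [set` A]]%classic| = #|A|.
Proof.
move=> f_inj; have -> : fset_set [set f i | i in [set` A]]%classic =
    [fset f i | i in A]%fset.
  apply/fsetP => t; rewrite in_fset_set; last exact: finite_image.
  apply/idP/imfsetP => [/set_mem[i iA <-]|[i iA ->]]; first by exists i.
  by apply/mem_set; exists i.
by rewrite card_in_imfset //= cardE.
Qed.

Section TilingCells.
Variables (R : realType) (V : finType) (K : simplicial_complex V) (n : nat).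
Hypotheses (n_gt0 : (0 < n)%N) (dimK : of_dimension K n).
Variable T : set (set {ffun V -> R}).
Hypothesis tilT : tiling K n T.

Let half_open_cell_inj p q :
  cell K n p -> cell K n q -> half_open p = half_open q :> set {ffun V -> R} -> p = q.
Proof.
move=> /and3P[_ /eqP p1 p21] /and3P[_ /eqP q1 q21].
by apply: half_open_inj; rewrite ?p1 ?q1.
Qed.

Definition tiling_cells : {set {set V} * {set V}} :=
  [set p | cell K n p && `[< T (half_open p) >] ]%SET.

Lemma hvect_tilingE s :
  hvect_tiling K n T s = #|[set p in tiling_cells | #|p.2| == s]%SET|.
Proof.
rewrite ffunE.
rewrite -(@card_fset_set_image _ _ (@half_open R V)); last first.
  move=> p q; rewrite !inE => /andP[/andP[cp _] _] /andP[/andP[cq _] _].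
  exact: half_open_cell_inj.
congr (#|` fset_set _|); apply/seteqP; split=> [t [Tt]|_ [p + <-]] /=.
  move=> /is_tileP[p [cp ps tE]]; exists p => //=.
  by rewrite !inE cp ps eqxx -tE andbT; apply/asboolP.
rewrite /= !inE => /andP[/andP[cp /asboolP Tp] /eqP ps]; split=> //.
by apply/is_tileP; exists p.
Qed.

(** The tiles cover the barycenter of tau exactly once if tau is a simplex of K;
    otherwise no simplex of K has tau as a face. *)
Lemma card_cells_between tau : tau != finset.set0 ->
  #|[set p in tiling_cells | between p tau]%SET| = (tau \in simplices K).
Proof.
case: tilT => tileT [coverT trivT _] tau0.
case: (boolP (tau \in _)) => [tauK|tauK]; last first.
  apply/eqP; rewrite cards_eq0; apply/eqP/setP => p; rewrite !inE.
  apply/negbTE; apply: contra tauK.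
  move=> /andP[/andP[/and3P[pK _ _] _]] /andP[_ tp].
  exact: simplex_face pK tp tau0.
have : realization K (barycenter R tau).
  by exists tau => //; apply/barycenter_hull => //.
rewrite -coverT => -[t Tt /= tx].
have [s /is_tileP[p [cp _ tE]]] := tileT t Tt.
suff -> : [set p in tiling_cells | between p tau]%SET = [set p]%SET.
  by rewrite cards1.
apply/setP => q; rewrite !inE; apply/idP/eqP => [|->]; last first.
  rewrite cp /=; apply/andP; split; first by apply/asboolP; rewrite -tE.
  by apply/(@barycenter_half_open R _ _ _ tau0); rewrite -tE.
move=> /andP[/andP[cq /asboolP Tq]] /(@barycenter_half_open R _ _ _ tau0) qx.
apply: half_open_cell_inj => //; rewrite -tE; apply: trivT => //.
by exists (barycenter R tau).
Qed.

Lemma hpoly_sum_simplices :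
  hpoly K n = ('X - 1) ^+ n.+1
    + \sum_(tau in simplices K) ('X - 1) ^+ (n.+1 - #|tau|).
Proof.
rewrite /hpoly big_ord_recl scale1r subn0; congr (_ + _).
have card_gt0 tau : tau \in simplices K -> (0 < #|tau|)%N.
  by move=> /simplex_nonempty; rewrite -card_gt0.
rewrite [RHS](partition_big
  (fun tau : {set V} => inord #|tau|.-1 : 'I_n.+1) predT) //=.
apply: eq_bigr => j _; rewrite /num_simplices.
rewrite (eq_bigl (mem [set tau in simplices K | #|tau| == j.+1]%SET)); last first.
  move=> tau; rewrite !inE; case: (boolP (tau \in _)) => //= tauK.
  have := card_gt0 _ tauK; have := dimK.2 _ tauK.
  case: #|tau| => //= m mn _; rewrite eqSS -val_eqE /= inordK //.
rewrite (eq_bigr (fun=> ('X - 1) ^+ (n.+1 - j.+1))); last first.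
  by move=> tau; rewrite !inE => /andP[_ /eqP ->].
by rewrite sumr_const scaler_nat.
Qed.

(** Double counting of the pairs (p, tau), where tau lies in the interval of the
    cell p of the tiling. *)
Lemma hvect_tiling_hpoly :
  \sum_(s < n.+2) (hvect_tiling K n T s)%:Z *: 'X^(n.+1 - s) =
  hpoly K n + ((hvect_tiling K n T ord0)%:Z - 1) *: ('X - 1) ^+ n.+1.
Proof.
have cellP p : p \in tiling_cells -> (#|p.1| = n.+1) /\ p.2 \subset p.1.
  by rewrite inE => /andP[/and3P[_ /eqP -> ->] _].
transitivity (\sum_(p in tiling_cells) 'X^(n.+1 - #|p.2|) : {poly int}).
  rewrite [RHS](partition_big
    (fun p : {set V} * {set V} => inord #|p.2| : 'I_n.+2) predT) //=.
  apply: eq_bigr => s _; rewrite hvect_tilingE.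
  rewrite [RHS](eq_bigl (mem [set p in tiling_cells | #|p.2| == s]%SET));
    last first.
    move=> p; rewrite [RHS]inE; case: (boolP (p \in _)) => //= /cellP[p1 p21].
    by rewrite -val_eqE /= inordK // !ltnS -p1 subset_leq_card.
  rewrite [RHS](eq_bigr (fun=> 'X^(n.+1 - s))); last first.
    by move=> p; rewrite !inE => /andP[_ /eqP ->].
  by rewrite sumr_const -scaler_nat natz.
transitivity (\sum_(p in tiling_cells) \sum_(tau | between p tau)
    ('X - 1) ^+ (n.+1 - #|tau|) : {poly int}).
  apply: eq_bigr => p /cellP[<- p21].
  by rewrite sum_between // subrK.
rewrite (exchange_big_dep predT) //=.
under eq_bigr => tau _.
  rewrite (eq_bigl (mem [set p in tiling_cells | between p tau]%SET));
    last first.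
    by move=> p; rewrite !inE.
  rewrite sumr_const; over.
(* The empty set lies in the intervals with empty bottom, those of type 0. *)
rewrite (bigD1 finset.set0) //= cards0 subn0 hpoly_sum_simplices.
have -> : [set p in tiling_cells | between p finset.set0]%SET =
          [set p in tiling_cells | #|p.2| == @ord0 n.+1]%SET.
  apply/setP => p; rewrite !inE /between finset.sub0set finset.subset0.
  by rewrite cards_eq0 andbT.
rewrite -hvect_tilingE scalerBl scale1r -scaler_nat natz.
rewrite [RHS]addrC addrA subrK; congr (_ + _).
rewrite [RHS]big_mkcond [LHS]big_mkcond; apply: eq_bigr => tau _ /=.
case: (eqVneq tau finset.set0) => [->|tau0] /=.
  by case: ifP => // /simplex_nonempty; rewrite eqxx.
by rewrite card_cells_between //; case: (tau \in _).
Qed.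

End TilingCells.

Lemma coef_sum_rev (S : nzRingType) n (a : 'I_n.+1 -> S) (s : 'I_n.+1) :
  (\sum_(i < n.+1) a i *: 'X^(n - i))`_(n - s) = a s.
Proof.
rewrite coef_sum (bigD1 s) //= coefZ coefXn eqxx mulr1 big1 ?addr0 // => i.
rewrite -val_eqE /= coefZ coefXn => ni.
case: eqP => [|_]; last by rewrite mulr0.
move=> /(congr1 (subn n)); rewrite !subKn ?leq_ord // => si.
by rewrite si eqxx in ni.
Qed.

Theorem theorem1p8 (R : realType) (V : finType) (K : simplicial_complex V)
    (n : nat) (n_gt0 : (0 < n)%N) (dimK : of_dimension K n)
    (tileK : tileable R K n) :
  (forall T T' : set (set {ffun V -> R}), tiling K n T -> tiling K n T' ->
     hvect_tiling K n T ord0 = hvect_tiling K n T' ord0 ->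
     hvect_tiling K n T = hvect_tiling K n T') /\
  (forall T : set (set {ffun V -> R}), tiling K n T ->
     hvect_tiling K n T ord0 = 1%N ->
     [ffun s => (hvect_tiling K n T s)%:Z] = hvect_complex K n).
Proof.
have hE (T : set (set {ffun V -> R})) s : tiling K n T ->
    (hvect_tiling K n T s)%:Z = (hpoly K n
      + ((hvect_tiling K n T ord0)%:Z - 1) *: ('X - 1) ^+ n.+1)`_(n.+1 - s).
  move=> tilT; rewrite -hvect_tiling_hpoly //.
  by rewrite (coef_sum_rev (fun s => (hvect_tiling K n T s)%:Z)).
split=> [T T' tilT tilT' h0|T tilT h0]; apply/ffunP => s.
  by apply/eqP; rewrite -eqz_nat (hE T) // (hE T') // h0.
by rewrite [LHS]ffunE hE // h0 subrr scale0r addr0 [RHS]ffunE.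
Qed.
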